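(* Let $f,g:\{0,1\}^n\to\{0,1\}$ be computed by an NUOBDD $N_n$ of width $c$ and an NUOBDD $N'_n$ of width $d$, respectively, where $N_n$ and $N'_n$ read the variables in the same order $\pi$. Then the function $f\cap g$, defined by $(f\cap g)(\sigma)=f(\sigma)\wedge g(\sigma)$, is computed by an NUOBDD of width $c\cdot d$.
   Context: A unitary OBDD (UOBDD) of width $d$ on $n$ variables is $(Q,|\psi^0\rangle,T,Q_{acc})$: $Q=\{q_1,\dots,q_d\}$ indexes an orthonormal basis of $\mathbb{C}^d$, $|\psi^0\rangle$ a unit vector, $Q_{acc}\subseteq Q$, $T=((i_j,U_j(0),U_j(1)))_{j=1}^n$ with $\pi=(i_1,\dots,i_n)$ a permutation of $\{1,\dots,n\}$ (the reading order) and $U_j(b)$ unitary $d\times d$ matrices. On input $\sigma$ the final state is $|\psi^n\rangle=U_n(\sigma_{i_n})\cdots U_1(\sigma_{i_1})|\psi^0\rangle$ and the acceptance probability is $\|P_{acc}|\psi^n\rangle\|^2$ with $P_{acc}$ the projection onto the span of accepting basis states. An NUOBDD computes $f$ if for all $\sigma$: $f(\sigma)=1$ iff the acceptance probability is nonzero. Its width is $d$. *)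

(* Defs.v *)
(* The complex numbers are R[i] for R : realType.                            *)
From mathcomp Require Import all_boot all_order all_fingroup all_algebra.
From mathcomp Require Export reals complex.

Set Implicit Arguments.
Unset Strict Implicit.
Unset Printing Implicit Defensive.

Import GRing.Theory Num.Theory.
Local Open Scope ring_scope.

(* Euclidean norm of a column vector; dotmx is the Hermitian product of row  *)
(* vectors.                                                                  *)
Definition vnorm (C : numClosedFieldType) (d : nat) (v : 'cV[C]_d) : C :=
  sqrtC (dotmx v^T v^T).

(* The set Q of states is 'I_d, its elements indexing the standard basis of  *)
(* the space 'cV_d. Positions in the program and variables are both          *)
(* numbered from 0: step j reads the variable uobdd_order j.                 *)
Record uobdd (C : numClosedFieldType) (n d : nat) : Type := UOBDD {
  uobdd_init : 'cV[C]_d;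
  uobdd_order : 'S_n;
  uobdd_trans : 'I_n -> bool -> 'M[C]_d;
  uobdd_acc : {set 'I_d};
  uobdd_init_unit : vnorm uobdd_init = 1;
  uobdd_trans_unitary : forall j b, uobdd_trans j b \is unitarymx
}.

(* enum 'I_n is increasing, so this is U_(n-1) *m (... *m (U_0 *m init)).    *)
Definition final_state (C : numClosedFieldType) (n d : nat)
    (N : uobdd C n d) (sigma : n.-tuple bool) : 'cV[C]_d :=
  foldl (fun psi j => uobdd_trans N j (tnth sigma (uobdd_order N j)) *m psi)
        (uobdd_init N) (enum 'I_n).

Definition acc_proj (C : numClosedFieldType) (n d : nat)
    (N : uobdd C n d) : 'M[C]_d :=
  diag_mx (\row_i (i \in uobdd_acc N)%:R).

Definition acc_prob (C : numClosedFieldType) (n d : nat)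
    (N : uobdd C n d) (sigma : n.-tuple bool) : C :=
  vnorm (acc_proj N *m final_state N sigma) ^+ 2.

Definition nuobdd_computes (C : numClosedFieldType) (n d : nat)
    (N : uobdd C n d) (f : n.-tuple bool -> bool) : Prop :=
  forall sigma, f sigma <-> acc_prob N sigma <> 0.

Definition fun_cap (n : nat) (f g : n.-tuple bool -> bool)
    (sigma : n.-tuple bool) : bool := f sigma && g sigma.

(* Main.v *)
Require Import Defs.
From mathcomp Require Import all_boot all_order all_fingroup all_algebra.
From mathcomp Require Import reals complex.
From mathcomp Require Import mxtens.

(** Run both programs in parallel on the tensor product of their state spaces,
    accepting the pairs of accepting states. The final state is the tensor
    product of the final states, so the acceptance probability is the product
    of the acceptance probabilities, and it is nonzero iff both factors are. *)

Set Implicit Arguments.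
Unset Strict Implicit.
Unset Printing Implicit Defensive.

Import GRing.Theory Num.Theory.
Local Open Scope ring_scope.

Lemma tens_diag_mx (R : pzRingType) (m n : nat) (u : 'rV[R]_m) (v : 'rV[R]_n) :
  diag_mx u *t diag_mx v = diag_mx (u *t v).
Proof.
apply/matrixP => k l.
case: (mxtens_indexP k) => i j; case: (mxtens_indexP l) => i' j'.
(* Pair indices coincide iff both components do, so the two Kronecker deltas multiply to a single
   one. *)
rewrite tensmxE !mxE !mxtens_indexK !(can_eq (@mxtens_indexK m n)) xpair_eqE.
rewrite mulrnAl mulrnAr -mulrnA mulnb andbC.
(* [u *t v] has [1 * 1] rows; the components of its row index lie in ['I_1], hence are 0. *)
by congr (u _ _ * v _ _ *+ _); rewrite [RHS]ord1.
Qed.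

Lemma tens_mx1 (R : pzRingType) (m n : nat) :
  1%:M *t 1%:M = 1%:M :> 'M[R]_(m * n).
Proof.
rewrite -!diag_const_mx tens_diag_mx; congr diag_mx.
by apply/rowP => k; rewrite !mxE mulr1.
Qed.

Section NumClosed.

Variable C : numClosedFieldType.

Lemma tens_unitarymx (m n p q : nat) (A : 'M[C]_(m, n)) (B : 'M[C]_(p, q)) :
  A \is unitarymx -> B \is unitarymx -> A *t B \is unitarymx.
Proof.
move=> /unitarymxP uA /unitarymxP uB; apply/unitarymxP.
by rewrite trmx_tens map_mxT tensmx_mul uA uB tens_mx1.
Qed.

(* The casts hold because [1 * 1] and [1] are convertible; they also explain
   why some rewrite rules below need explicit matrices. *)
Lemma dotmx_tens (m n : nat) (u u' : 'rV[C]_m) (v v' : 'rV[C]_n) :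
  dotmx (u *t v : 'rV_(m * n)) (u' *t v' : 'rV_(m * n)) =
  dotmx u u' * dotmx v v'.
Proof.
rewrite !dotmxE (trmx_tens u' v') (map_mxT Num.conj u'^T v'^T).
have -> := tensmx_mul u v (map_mx Num.conj u'^T) (map_mx Num.conj v'^T).
by rewrite mxE ![(mxtens_unindex _).1]ord1 ![(mxtens_unindex _).2]ord1.
Qed.

Lemma vnorm_tens (m n : nat) (u : 'cV[C]_m) (v : 'cV[C]_n) :
  vnorm (u *t v : 'cV_(m * n)) = vnorm u * vnorm v.
Proof.
(* [sqrtCM] requires both factors to be nonnegative, which holds for squared norms. *)
rewrite /vnorm (trmx_tens u v) dotmx_tens sqrtCM // nnegrE.
  exact: (dnorm_ge0 (@dotmx C m)).
exact: (dnorm_ge0 (@dotmx C n)).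
Qed.

Section Tensor.

Variables (n c d : nat) (N : uobdd C n c) (N' : uobdd C n d).

Let init : 'cV[C]_(c * d) := uobdd_init N *t uobdd_init N'.

Let init_unit : vnorm init = 1.
Proof. by rewrite vnorm_tens !uobdd_init_unit mulr1. Qed.

Let trans_unitary j b : uobdd_trans N j b *t uobdd_trans N' j b \is unitarymx.
Proof. by apply: tens_unitarymx; exact: uobdd_trans_unitary. Qed.

Definition uobdd_tens : uobdd C n (c * d) :=
  UOBDD (uobdd_order N)
    [set k | ((mxtens_unindex k).1 \in uobdd_acc N)
           & ((mxtens_unindex k).2 \in uobdd_acc N')]
    init_unit trans_unitary.

Lemma acc_proj_tens : acc_proj uobdd_tens = acc_proj N *t acc_proj N'.
Proof.
rewrite tens_diag_mx; congr diag_mx.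
by apply/rowP => k; rewrite !mxE inE -natrM mulnb.
Qed.

Hypothesis same_order : uobdd_order N = uobdd_order N'.

(** The common order makes both programs read the same bit at each step, so by the mixed-product
    rule a step of [uobdd_tens] acts on each tensor factor separately. *)
Lemma final_state_tens sigma :
  final_state uobdd_tens sigma = final_state N sigma *t final_state N' sigma.
Proof.
rewrite /final_state -same_order /= /init.
(* [foldl] changes its accumulator, so both initial states are generalized. *)
elim: (enum 'I_n) (uobdd_init N) (uobdd_init N') => //= j s IHs psi psi'.
by rewrite -IHs -tensmx_mul.
Qed.

Lemma acc_prob_tens sigma :
  acc_prob uobdd_tens sigma = acc_prob N sigma * acc_prob N' sigma.
Proof.
rewrite /acc_prob acc_proj_tens final_state_tens.
by rewrite -exprMn -vnorm_tens -tensmx_mul.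
Qed.

End Tensor.

End NumClosed.

Theorem theorem15 (R : realType) (n c d : nat)
    (f g : n.-tuple bool -> bool)
    (N : uobdd R[i] n c) (N' : uobdd R[i] n d)
    (Nf : nuobdd_computes N f) (N'g : nuobdd_computes N' g)
    (same_order : uobdd_order N = uobdd_order N') :
  exists M : uobdd R[i] n (c * d), nuobdd_computes M (fun_cap f g).
Proof.
exists (uobdd_tens N N') => sigma.
rewrite acc_prob_tens // /fun_cap.
split=> [/andP[/Nf /eqP p0 /N'g /eqP q0]|/eqP].
  by apply/eqP; rewrite mulf_neq0.
rewrite mulf_eq0 negb_or => /andP[/eqP p0 /eqP q0].
by apply/andP; split; [apply/Nf | apply/N'g].
Qed.
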